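(* Let $G$ be a bipartite graph on $n$ vertices and let $\frac{1}{2}<\alpha<1$. Then $$\lambda_n(A_{\alpha}(G))\leq \lambda_{n}\big(A_{\alpha}(K_{\lceil n/2\rceil,\lfloor n/2\rfloor})\big),$$ with equality if and only if $G\cong K_{\lceil n/2\rceil,\lfloor n/2\rfloor}$.
   Context: All graphs are finite, simple and undirected. For a graph $G$ with adjacency matrix $A(G)$ and diagonal degree matrix $D(G)$, and a real $\alpha\in[0,1]$, $A_{\alpha}(G)=\alpha D(G)+(1-\alpha)A(G)$. Its eigenvalues are denoted $\lambda_1(A_\alpha(G))\geq\cdots\geq\lambda_n(A_\alpha(G))$. $K_{a,b}$ is the complete bipartite graph with parts of sizes $a$ and $b$. *)

(* Defs.v *)
From HB Require Import structures.
From mathcomp Require Import all_boot all_order all_algebra.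
From mathcomp Require Import boolp classical_sets reals.

Set Implicit Arguments.
Unset Strict Implicit.
Unset Printing Implicit Defensive.

Import Order.TTheory GRing.Theory Num.Theory.

Local Open Scope ring_scope.

Record sgraph := SGraph {
  vertex :> finType;
  adj : rel vertex;
  adj_sym : symmetric adj;
  adj_irrefl : irreflexive adj
}.

Definition deg (G : sgraph) (x : G) : nat := #|[set y | adj x y]|.

Definition isomorphic (G H : sgraph) : Prop :=
  exists2 f : G -> H, bijective f & forall x y, adj (f x) (f y) = adj x y.

(* One of the two parts [X] and [~: X] may be empty. *)
Definition bipartite (G : sgraph) : Prop :=
  exists X : {set G}, forall x y, adj x y -> (x \in X) != (y \in X).

Section CompleteBipartite.
Variables a b : nat.

Definition Kab_adj : rel ('I_a + 'I_b)%type := fun u v =>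
  match u, v with
  | inl _, inr _ | inr _, inl _ => true
  | _, _ => false
  end.

Fact Kab_sym : symmetric Kab_adj. Proof. by move=> [?|?] [?|?]. Qed.

Fact Kab_irrefl : irreflexive Kab_adj. Proof. by case. Qed.

Definition Kab : sgraph := SGraph Kab_sym Kab_irrefl.

End CompleteBipartite.

Section Matrices.
Variable R : realType.

(* Vertices are numbered by [enum_val : 'I_#|G| -> G]; another numbering would
   only conjugate these matrices by a permutation matrix. *)
Definition adj_mx (G : sgraph) : 'M[R]_#|G| :=
  \matrix_(i, j) (adj (enum_val i) (enum_val j))%:R.

Definition deg_mx (G : sgraph) : 'M[R]_#|G| :=
  diag_mx (\row_i (deg (enum_val i))%:R).

Definition A_alpha (alpha : R) (G : sgraph) : 'M[R]_#|G| :=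
  alpha *: deg_mx G + (1 - alpha) *: adj_mx G.

(* [s] lists the roots of the characteristic polynomial of [M], all of them
   in [R], with multiplicity and in nonincreasing order. *)
Definition is_spectrum (m : nat) (M : 'M[R]_m) (s : seq R) : Prop :=
  sorted >=%R s /\ char_poly M = \prod_(x <- s) ('X - x%:P).

(* [is_spectrum M] has at most one element, and exactly one when [M] is
   symmetric; [[::]] is only a default for matrices with non-real eigenvalues. *)
Definition spectrum (m : nat) (M : 'M[R]_m) : seq R :=
  xget [::] [set s | is_spectrum M s]%classic.

(* The [k]-th largest eigenvalue, counted from [k = 1]. *)
Definition lambda (k : nat) (m : nat) (M : 'M[R]_m) : R :=
  (spectrum M)`_k.-1.

End Matrices.

(* Main.v *)
(** For alpha > 1/2 the form [f p q = alpha (p^2 + q^2) + 2 (1 - alpha) p q] is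
    positive definite. If G has parts of sizes a, b and e edges, the vector
    equal to p on one part and q on the other gives, by Rayleigh,
    [lambda_n (a p^2 + b q^2) <= e f p q <= a b f p q]. Any eigenvalue mu of
    the balanced complete bipartite graph satisfies
    [mu^2 - alpha n mu + (2 alpha - 1) m <= 0] with m the product of its part
    sizes. As [a b <= m], the same inequality holds with [a b] in place of m,
    and it says that the binary form [a b f p q - mu (a p^2 + b q^2)] has
    determinant at most 0, so it takes a nonpositive value at some nonzero
    (p, q). Equality forces [e = a b = m]. *)
Require Import Defs.
From HB Require Import structures.
From mathcomp Require Import all_boot all_order all_algebra perm.
From mathcomp Require Import boolp classical_sets reals.
From mathcomp Require Import spectral sesquilinear complex ring lra zify.

Set Implicit Arguments.
Unset Strict Implicit.
Unset Printing Implicit Defensive.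

Import Order.TTheory GRing.Theory Num.Theory.

Local Open Scope ring_scope.

(** * Spectral theory of real symmetric matrices *)

Lemma char_poly_conj (F : fieldType) (m : nat) (P D : 'M[F]_m) :
  P \in unitmx -> char_poly (invmx P *m D *m P) = char_poly D.
Proof.
move=> uP; rewrite /char_poly /char_poly_mx !map_mxM.
have uP' : map_mx (@polyC F) P \in unitmx by rewrite map_unitmx.
have {1}-> : 'X%:M = map_mx (@polyC F) (invmx P) *m 'X%:M *m map_mx (@polyC F) P.
  by rewrite map_invmx scalar_mxC mulmxKV.
rewrite -mulmxBl -mulmxBr !det_mulmx map_invmx det_inv mulrAC mulVr ?mul1r //.
Qed.

Section RealSymmetric.
Variables (R : realType) (m : nat) (M : 'M[R]_m).
Hypothesis symM : M^T = M.

Local Notation toC := (real_complex R).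

(** The complexification of [M] is Hermitian, hence unitarily diagonalizable with real eigenvalues.
    Only [d] descends to [R]; [P] stays complex. *)
Lemma real_symmetric_spectral : exists (P : 'M[R[i]]_m) (d : 'I_m -> R),
  P \is unitarymx /\
  map_mx toC M = invmx P *m diag_mx (\row_i toC (d i)) *m P.
Proof.
pose A := map_mx toC M.
have symA : A \is symmetricmx.
  apply/is_hermitianmxP; rewrite expr0 scale1r; apply/matrixP => i j.
  by rewrite !mxE -{1}symM mxE.
have realA : A \is a realmx.
  by apply/mxOverP => i j; rewrite !mxE; apply/complex_realP; exists (M i j).
have hermA := realsym_hermsym symA realA.
exists (spectralmx A), (fun i => complex.Re (spectral_diag A 0 i)).
split; first exact: spectral_unitarymx.
have /hermitian_normalmx/orthomx_spectralP AE := hermA; rewrite -/A [LHS]AE.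
congr (_ *m diag_mx _ *m _); apply/rowP => i; rewrite mxE RRe_real //.
exact: (mxOverP (hermitian_spectral_diag_real hermA)).
Qed.

(** In the coordinates [y] given by [P], the form of [M] is the sum of [d i] times the squared
    modulus of [y 0 i]. One [d] serves both claims, which lets [rayleigh] pass from the form to
    [lambda]. *)
Lemma real_symmetric_char_poly : exists2 d : 'I_m -> R,
  char_poly M = \prod_i ('X - (d i)%:P) &
  forall (c : R) (v : 'I_m -> R), (forall i, c <= d i) ->
    c * (\sum_i v i ^+ 2) <= \sum_i \sum_j v i * M i j * v j.
Proof.
have [P [d [unitP MC]]] := real_symmetric_spectral.
have uP := unitarymx_unit unitP.
exists d.
  apply: (map_poly_inj toC); rewrite map_char_poly MC char_poly_conj //.
  rewrite char_poly_trig; last exact/diag_mx_is_trig.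
  rewrite rmorph_prod; apply: eq_bigr => i _.
  by rewrite !mxE eqxx mulr1n rmorphB /= map_polyX map_polyC.
move=> c v cd; rewrite -lecR -subr_ge0.
pose w : 'rV[R[i]]_m := \row_i toC (v i).
pose y := w *m invmx P.
(* [P] is unitary and [w] is real, so the conjugate transpose of [w *m invmx P] is [P *m w^T]. *)
have ytE : (map_mx Num.conj y)^T = P *m w^T.
  rewrite map_mxM invmx_unitary // -map_mx_comp (map_mx_id (@conjCK _)).
  rewrite trmx_mul trmxK; congr (_ *m _^T); apply/rowP => i; rewrite !mxE.
  by apply/CrealP/complex_realP; exists (v i).
have quadE (f : 'I_m -> R[i]) :
    (w *m (invmx P *m diag_mx (\row_i f i) *m P) *m w^T) 0 0 =
    \sum_i f i * (y 0 i * (y 0 i)^*).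
  rewrite !mulmxA -/y -mulmxA -ytE mul_mx_diag mxE.
  by apply: eq_bigr => i _; rewrite !mxE mulrAC mulrA mulrC !mulrA.
have quadC (B : 'M[R]_m) : (w *m map_mx toC B *m w^T) 0 0 =
    toC (\sum_i \sum_j v i * B i j * v j).
  rewrite exchange_big rmorph_sum mxE /=; apply: eq_bigr => j _.
  rewrite !mxE rmorph_sum mulr_suml; apply: eq_bigr => i _.
  by rewrite !mxE !rmorphM.
(* The case [f = 1] of [quadE]: the change of coordinates preserves the norm. *)
have sqE : toC (\sum_i v i ^+ 2) = \sum_i (y 0 i * (y 0 i)^*).
  have := quadE (fun=> 1); under [RHS]eq_bigr do rewrite mul1r.
  move=> <-; have -> : \row_(i < m) (1 : R[i]) = const_mx 1.
    by apply/rowP => i; rewrite !mxE.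
  rewrite diag_const_mx mulmx1 mulVmx // mulmx1 mxE rmorph_sum /=.
  by apply: eq_bigr => i _; rewrite !mxE rmorphXn expr2.
rewrite rmorphM /= sqE -quadC MC quadE mulr_sumr -sumrB.
apply: sumr_ge0 => i _; rewrite -mulrBl mulr_ge0 ?mul_conjC_ge0 //.
by rewrite subr_ge0 lecR.
Qed.

(** The sorted eigenvalues from the diagonalization witness existence, so [xget] never returns its
    default [[::]]. *)
Lemma spectrumP : is_spectrum M (spectrum M).
Proof.
have [d dE _] := real_symmetric_char_poly.
rewrite /spectrum; case: xgetP => [s _ //|/(_ (sort >=%R (codom d)))].
case; split; first by apply: sort_sorted => x y; exact: le_total.
rewrite (perm_big (codom d)) ?perm_sort //= dE.
by rewrite big_map big_enum.
Qed.

Lemma size_spectrum : size (spectrum M) = m.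
Proof.
have [_ /(congr1 (fun p : {poly R} => size p))] := spectrumP.
by rewrite size_char_poly size_prod_XsubC => -[].
Qed.

Lemma mem_lambda : (0 < m)%N -> lambda m M \in spectrum M.
Proof. by move=> m0; rewrite mem_nth // size_spectrum prednK. Qed.

Lemma lambda_eigenvalue : (0 < m)%N -> eigenvalue M (lambda m M).
Proof.
move=> m0; rewrite eigenvalue_root_char spectrumP.2 root_prod_XsubC.
exact: mem_lambda.
Qed.

Lemma lambda_le_spectrum (x : R) : x \in spectrum M -> lambda m M <= x.
Proof.
move=> xs; have := xs; rewrite -index_mem size_spectrum => im.
rewrite -(nth_index 0 xs).
have geT : transitive (>=%R : rel R) by move=> b a c ba cb; exact: le_trans ba.
have m0 : (0 < m)%N by exact: leq_ltn_trans im.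
apply: (sorted_leq_nth geT (@lexx _ R) 0 spectrumP.1);
  rewrite ?inE ?size_spectrum ?prednK //.
by rewrite -ltnS prednK.
Qed.

Lemma rayleigh (v : 'I_m -> R) :
  lambda m M * (\sum_i v i ^+ 2) <= \sum_i \sum_j v i * M i j * v j.
Proof.
have [d dE] := real_symmetric_char_poly; apply => i.
apply: lambda_le_spectrum.
rewrite -root_prod_XsubC -spectrumP.2 dE (bigD1 i) //= rootM.
by rewrite root_XsubC eqxx.
Qed.

End RealSymmetric.

(** * Invariance under renumbering and graph isomorphism *)

Lemma char_poly_reindex (R : comNzRingType) (m k : nat) (M : 'M[R]_m)
    (N : 'M[R]_k) (f : 'I_m -> 'I_k) :
  bijective f -> (forall i j, N (f i) (f j) = M i j) ->
  char_poly M = char_poly N.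
Proof.
(* Bijectivity forces [m = k]; once the sizes are identified, [f] is a permutation whose sign occurs
   twice in the determinant and cancels. *)
move=> bij_f; have := bij_eq_card bij_f; rewrite !card_ord => mk.
move: N f bij_f; rewrite -mk => N f /bij_inj inj_f NM.
rewrite /char_poly.
have -> : char_poly_mx M =
    row_perm (perm inj_f) (col_perm (perm inj_f) (char_poly_mx N)).
  by apply/matrixP => i j; rewrite !mxE !permE (inj_eq inj_f) NM.
rewrite row_permE col_permE !det_mulmx !det_perm odd_permV.
by rewrite [X in _ * X]mulrC signrMK.
Qed.

Lemma isomorphic_sym (G H : sgraph) : isomorphic G H -> isomorphic H G.
Proof.
case=> f [g fg gf] adj_f; exists g; first by exists f.
by move=> x y; rewrite -adj_f !gf.
Qed.

Lemma deg_isomorphic (G H : sgraph) (f : G -> H) :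
  bijective f -> (forall x y, adj (f x) (f y) = adj x y) ->
  forall x, deg (f x) = deg x.
Proof.
move=> bij_f adj_f x; rewrite /deg.
rewrite -(on_card_preimset (onW_bij _ bij_f)).
by apply: eq_card => y; rewrite !inE adj_f.
Qed.

(** * The quadratic form and the eigenvectors of [A_alpha] *)

Section Graphs.
Variable R : realType.
Implicit Types (alpha mu : R) (G H : sgraph).

Lemma lambda_isomorphic alpha k G H :
  isomorphic G H -> lambda k (A_alpha alpha G) = lambda k (A_alpha alpha H).
Proof.
case=> f bij_f adj_f.
pose g (i : 'I_#|G|) := enum_rank (f (enum_val i)).
have bij_g : bijective g.
  exact: bij_comp (enum_rank_bij _) (bij_comp bij_f (enum_val_bij _)).
(* The spectrum depends on a matrix only through its characteristic polynomial, so matrices of sizes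
   [#|G|] and [#|H|] can be compared directly. *)
rewrite /lambda /spectrum /is_spectrum.
rewrite (char_poly_reindex bij_g (N := A_alpha alpha H)) //.
move=> i j; rewrite !mxE !enum_rankK adj_f (deg_isomorphic bij_f) //.
by rewrite (bij_eq bij_g).
Qed.

Lemma A_alpha_sym alpha G : (A_alpha alpha G)^T = A_alpha alpha G.
Proof.
apply/matrixP => i j; rewrite !mxE adj_sym eq_sym.
by case: eqP => [->|].
Qed.

Lemma sum_enum_val (V : nmodType) (T : finType) (F : T -> V) :
  \sum_(i < #|T|) F (enum_val i) = \sum_x F x.
Proof. by rewrite [RHS](reindex _ (onW_bij _ (enum_val_bij T))). Qed.

Lemma degE G (x : G) : (deg x)%:R = \sum_y (adj x y)%:R :> R.
Proof.
rewrite /deg -sum1_card natr_sum big_mkcond /=.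
by apply: eq_bigr => y _; rewrite inE; case: adj.
Qed.

Lemma A_alpha_enum_rank alpha G (x y : G) :
  A_alpha alpha G (enum_rank x) (enum_rank y) =
  alpha * ((deg x)%:R *+ (x == y)) + (1 - alpha) * (adj x y)%:R.
Proof. by rewrite !mxE !enum_rankK (inj_eq enum_rank_inj). Qed.

(** Writing each degree as a sum over neighbours turns the form into a sum over ordered adjacent
    pairs. The summand is not symmetric in [x] and [y]. *)
Lemma A_alpha_quad alpha G (g : G -> R) :
  \sum_i \sum_j g (enum_val i) * A_alpha alpha G i j * g (enum_val j) =
  \sum_x \sum_y (adj x y)%:R * (alpha * g x ^+ 2 + (1 - alpha) * (g x * g y)).
Proof.
rewrite -[RHS]sum_enum_val; apply: eq_bigr => i _.
under eq_bigr do rewrite !mxE mulrDr mulrDl.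
under [RHS]eq_bigr do rewrite mulrDr.
rewrite !big_split /= -!mulr_suml -degE; congr (_ + _).
  rewrite (bigD1 i) //= eqxx big1 ?addr0; first by rewrite mulr1n; ring.
  by move=> j /negPf; rewrite eq_sym => ->; rewrite mulr0n !(mulr0, mul0r).
rewrite -[RHS]sum_enum_val; apply: eq_bigr => j _; ring.
Qed.

Lemma A_alpha_eigenvector alpha mu G : eigenvalue (A_alpha alpha G) mu ->
  exists2 w : G -> R, exists x, w x != 0 &
  forall x, alpha * (deg x)%:R * w x +
    (1 - alpha) * (\sum_y (adj x y)%:R * w y) = mu * w x.
Proof.
case/eigenvalueP => v vM v0; exists (fun x => v 0 (enum_rank x)).
  have /rV0Pn[i vi] : v != 0 by [].
  by exists (enum_val i); rewrite enum_valK.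
move=> x; have /rowP/(_ (enum_rank x)) := vM; rewrite !mxE => <-.
rewrite (reindex _ (onW_bij _ (enum_rank_bij G))) /=.
under [RHS]eq_bigr do rewrite A_alpha_enum_rank mulrDr.
rewrite big_split /=; congr (_ + _).
  rewrite (bigD1 x) //= eqxx big1 ?addr0; first by rewrite mulr1n; ring.
  by move=> j /negPf ->; rewrite mulr0n !mulr0.
by rewrite mulr_sumr; apply: eq_bigr => y _; rewrite adj_sym; ring.
Qed.

Lemma sum_Kab (V : nmodType) (a b : nat) (F : Kab a b -> V) :
  \sum_x F x = \sum_(i < a) F (inl i) + \sum_(j < b) F (inr j).
Proof. exact: big_sumType. Qed.

(** The sums [S], [T] of an eigenvector over the two parts solve a homogeneous 2 by 2 system with
    determinant [chi]. Either [chi = 0], or both sums vanish and [mu] is [alpha * a] or [alpha * b];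
    the inequality covers both cases. *)
Lemma Kab_eigenvalue alpha mu (a b : nat) :
  eigenvalue (A_alpha alpha (Kab a b)) mu ->
  (alpha * a%:R - mu) * (alpha * b%:R - mu) <=
    (1 - alpha) ^+ 2 * (a%:R * b%:R).
Proof.
case/A_alpha_eigenvector => w [x0 wx0] wE.
pose S := \sum_(i < a) w (inl i); pose T := \sum_(j < b) w (inr j).
have degl i : (deg (inl i : Kab a b))%:R = b%:R :> R.
  by rewrite degE sum_Kab /= big1 // add0r sumr_const card_ord.
have degr j : (deg (inr j : Kab a b))%:R = a%:R :> R.
  by rewrite degE sum_Kab /= [X in _ + X]big1 // addr0 sumr_const card_ord.
have wl i : (alpha * b%:R - mu) * w (inl i) + (1 - alpha) * T = 0.
  have := wE (inl i); rewrite degl sum_Kab /= big1 => [|? _];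
    last exact: mul0r.
  rewrite add0r (eq_bigr (fun j => w (inr j))) => [|? _];
    last exact: mul1r.
  by rewrite -/T => /eqP; rewrite -subr_eq0 => /eqP <-; ring.
have wr j : (alpha * a%:R - mu) * w (inr j) + (1 - alpha) * S = 0.
  have := wE (inr j); rewrite degr sum_Kab /= [X in _ * (_ + X)]big1 => [|? _];
    last exact: mul0r.
  rewrite addr0 (eq_bigr (fun j => w (inl j))) => [|? _];
    last exact: mul1r.
  by rewrite -/S => /eqP; rewrite -subr_eq0 => /eqP <-; ring.
have sumS : (alpha * b%:R - mu) * S + (1 - alpha) * (a%:R * T) = 0.
  have : \sum_(i < a) ((alpha * b%:R - mu) * w (inl i) + (1 - alpha) * T) = 0.
    by apply: big1 => i _; exact: wl.
  rewrite big_split /= -mulr_sumr sumr_const card_ord -/S -mulr_natl.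
  by move=> <-; ring.
have sumT : (alpha * a%:R - mu) * T + (1 - alpha) * (b%:R * S) = 0.
  have : \sum_(j < b) ((alpha * a%:R - mu) * w (inr j) + (1 - alpha) * S) = 0.
    by apply: big1 => i _; exact: wr.
  rewrite big_split /= -mulr_sumr sumr_const card_ord -/T -mulr_natl.
  by move=> <-; ring.
have abpos : 0 <= (1 - alpha) ^+ 2 * (a%:R * b%:R).
  by rewrite mulr_ge0 ?sqr_ge0 ?mulr_ge0.
pose chi := (alpha * a%:R - mu) * (alpha * b%:R - mu) -
  (1 - alpha) ^+ 2 * (a%:R * b%:R).
have [S0|S0] := eqVneq S 0; last first.
  have : chi * S = 0.
    (* Elimination of [T] between [sumS] and [sumT]. *)
    have -> : chi * S =
      (alpha * a%:R - mu) * ((alpha * b%:R - mu) * S + (1 - alpha) * (a%:R * T))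
      - (1 - alpha) * a%:R * ((alpha * a%:R - mu) * T + (1 - alpha) * (b%:R * S))
      by rewrite /chi; ring.
    by rewrite sumS sumT !mulr0 subr0.
  by move/eqP; rewrite mulf_eq0 (negPf S0) orbF subr_eq0 => /eqP ->.
have [T0|T0] := eqVneq T 0; last first.
  have : chi * T = 0.
    have -> : chi * T =
      (alpha * b%:R - mu) * ((alpha * a%:R - mu) * T + (1 - alpha) * (b%:R * S))
      - (1 - alpha) * b%:R * ((alpha * b%:R - mu) * S + (1 - alpha) * (a%:R * T))
      by rewrite /chi; ring.
    by rewrite sumS sumT !mulr0 subr0.
  by move/eqP; rewrite mulf_eq0 (negPf T0) orbF subr_eq0 => /eqP ->.
(* With [S = T = 0], the nonzero entry of [w] makes one factor on the left vanish. *)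
case: x0 wx0 => i wi.
  have /eqP := wl i; rewrite T0 mulr0 addr0 mulf_eq0 (negPf wi) orbF => /eqP ->.
  by rewrite mulr0.
have /eqP := wr i; rewrite S0 mulr0 addr0 mulf_eq0 (negPf wi) orbF => /eqP ->.
by rewrite mul0r.
Qed.

End Graphs.

(** * A nonpositive value of a binary quadratic form *)

(** The form [a * b * f - mu * N] has diagonal coefficients [A], [C] and half cross coefficient [B].
    Its determinant [a * b * D] is at most 0, and a suitable [(p, q)] is chosen according to the
    signs of [A] and [C]. *)
Lemma test_vector (R : realFieldType) (alpha mu a b m : R) :
  1 / 2 < alpha -> alpha < 1 -> 0 < mu -> 0 <= a -> 0 <= b -> 0 < a + b ->
  a * b <= m -> mu ^+ 2 + (2 * alpha - 1) * m <= alpha * (a + b) * mu ->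
  exists p q : R,
  let f := alpha * (p ^+ 2 + q ^+ 2) + 2 * (1 - alpha) * (p * q) in
  let N := a * p ^+ 2 + b * q ^+ 2 in
  [/\ 0 < N, 0 < f, a * b * f <= mu * N & a * b < m -> a * b * f < mu * N].
Proof.
move=> al1 al2 mu0 a0 b0 ab0 abm chi.
pose A := a * (alpha * b - mu); pose B := (1 - alpha) * (a * b).
pose C := b * (alpha * a - mu).
pose D := mu ^+ 2 + (2 * alpha - 1) * (a * b) - alpha * (a + b) * mu.
have formE p q :
    a * b * (alpha * (p ^+ 2 + q ^+ 2) + 2 * (1 - alpha) * (p * q)) -
    mu * (a * p ^+ 2 + b * q ^+ 2) = A * p ^+ 2 + 2 * B * (p * q) + C * q ^+ 2.
  by rewrite /A /B /C; ring.
have detE : A * C - B ^+ 2 = a * b * D by rewrite /A /B /C /D; ring.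
have f_gt0 p q : (p != 0) || (q != 0) ->
    0 < alpha * (p ^+ 2 + q ^+ 2) + 2 * (1 - alpha) * (p * q).
  move=> pq.
  have s0 : 0 < p ^+ 2 + q ^+ 2.
    rewrite lt_neqAle eq_sym paddr_eq0 ?sqr_ge0 // !sqrf_eq0 negb_and pq.
    by rewrite addr_ge0 ?sqr_ge0.
  (* This splitting shows positivity: [1 / 2 < alpha] makes the first coefficient positive. *)
  have -> : alpha * (p ^+ 2 + q ^+ 2) + 2 * (1 - alpha) * (p * q) =
    (2 * alpha - 1) * (p ^+ 2 + q ^+ 2) + (1 - alpha) * (p + q) ^+ 2 by ring.
  apply: ltr_pwDl; first by apply: mulr_gt0 => //; lra.
  by apply: mulr_ge0; [lra | exact: sqr_ge0].
(* Replacing [m] by [a * b] in [chi] lowers its left side by [(2 * alpha - 1) * (m - a * b)], which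
   is positive when [a * b < m]. *)
have D_le0 : D <= 0 by rewrite /D; nra.
have D_lt0 : a * b < m -> D < 0 by rewrite /D; nra.
have [A0|A0] := ltP 0 A.
  have b1 : 0 < b.
    rewrite lt_neqAle b0 andbT; apply/eqP => bE.
    by move: A0; rewrite /A -bE; nra.
  have a1 : 0 < a.
    rewrite lt_neqAle a0 andbT; apply/eqP => aE.
    by move: A0; rewrite /A -aE; nra.
  (* The vector [(B, - A)] is the critical point in [p] for fixed [q = - A]; the value there is [A]
     times the determinant. *)
  have val : A * B ^+ 2 + 2 * B * (B * - A) + C * (- A) ^+ 2 = A * (a * b) * D.
    by rewrite -[RHS]mulrA -detE; ring.
  have c0 : 0 < A * (a * b) by apply: mulr_gt0 => //; exact: mulr_gt0.
  exists B, (- A); split.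
  - apply: ltr_wpDl; first by rewrite mulr_ge0 ?sqr_ge0.
    by rewrite mulr_gt0 // sqrrN exprn_gt0.
  - by apply: f_gt0; rewrite oppr_eq0 (gt_eqF A0) orbT.
  - by rewrite -subr_le0 formE val pmulr_rle0.
  - by move=> /D_lt0 D0; rewrite -subr_lt0 formE val pmulr_rlt0.
have [C0|C0] := ltP 0 C.
  have b1 : 0 < b.
    rewrite lt_neqAle b0 andbT; apply/eqP => bE.
    by move: C0; rewrite /C -bE; nra.
  have a1 : 0 < a.
    rewrite lt_neqAle a0 andbT; apply/eqP => aE.
    by move: C0; rewrite /C -aE; nra.
  have val : A * (- C) ^+ 2 + 2 * B * (- C * B) + C * B ^+ 2 = C * (a * b) * D.
    by rewrite -[RHS]mulrA -detE; ring.
  have c0 : 0 < C * (a * b) by apply: mulr_gt0 => //; exact: mulr_gt0.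
  exists (- C), B; split.
  - apply: ltr_pwDl; last by rewrite mulr_ge0 ?sqr_ge0.
    by rewrite mulr_gt0 // sqrrN exprn_gt0.
  - by apply: f_gt0; rewrite oppr_eq0 (gt_eqF C0).
  - by rewrite -subr_le0 formE val pmulr_rle0.
  - by move=> /D_lt0 D0; rewrite -subr_lt0 formE val pmulr_rlt0.
(* Here [A] and [C] are at most 0 and [B] is nonnegative, so opposite signs give [A + C - 2 * B]. It
   is negative through [B] if [a * b] is nonzero, and through [- mu * (a + b)] otherwise. *)
have val : A * 1 ^+ 2 + 2 * B * (1 * -1) + C * (-1) ^+ 2 < 0.
  have -> : A * 1 ^+ 2 + 2 * B * (1 * -1) + C * (-1) ^+ 2 = A + C - 2 * B by ring.
  have AC : A + C = 2 * alpha * (a * b) - mu * (a + b) by rewrite /A /C; ring.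
  have mab : 0 < mu * (a + b) by rewrite mulr_gt0.
  have [/eqP ab|ab] := eqVneq (a * b) 0.
    by rewrite AC /B (eqP ab); lra.
  have ab1 : 0 < a * b by rewrite lt_neqAle eq_sym ab mulr_ge0.
  have : 0 < B by rewrite mulr_gt0 ?subr_gt0.
  lra.
exists 1, (-1); split.
- by rewrite sqrrN expr1n !mulr1.
- by apply: f_gt0; rewrite oner_eq0.
- by rewrite -subr_le0 formE ltW.
- by move=> _; rewrite -subr_lt0 formE.
Qed.

(** * Products of two naturals with a given sum *)

(** For [a + b = 2 * h + o] with [o] the parity, [(a - h) * (b - h) = a * b - h * (h + o)] over the
    integers, and the two factors never have the same strict sign. *)
Lemma mul_le_halves (a b n : nat) :
  (a + b = n)%N -> (a * b <= uphalf n * n./2)%N.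
Proof.
move=> <-; rewrite uphalf_half; have := odd_double_half (a + b).
move: (odd _) ((a + b)./2) => o h E.
have : (a%:Z - h%:Z) * (b%:Z - h%:Z) <= 0.
  have [ah|ah] := leqP a h.
    by apply: mulr_le0_ge0; lia.
  by apply: mulr_ge0_le0; lia.
by nia.
Qed.

Lemma mul_eq_halves (a b n : nat) :
  (a + b = n)%N -> (a * b = uphalf n * n./2)%N -> a = n./2 \/ b = n./2.
Proof.
move=> <-; rewrite uphalf_half; have := odd_double_half (a + b).
move: (odd _) ((a + b)./2) => o h E1 E2.
have : ((a%:Z - h%:Z) * (b%:Z - h%:Z) = 0)%R by nia.
move/eqP; rewrite mulf_eq0 !subr_eq0 => /orP[] /eqP; lia.
Qed.

(** * Graphs with a fixed bipartition *)

Section Bipartition.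
Variables (G : sgraph) (X : {set G}).
Hypothesis adjX : forall x y, adj x y -> (x \in X) != (y \in X).

Lemma sum_bipartition (R : nmodType) (p q : R) :
  \sum_x (if x \in X then p else q) = p *+ #|X| + q *+ #|~: X|.
Proof.
rewrite (bigID (mem X)) /= (eq_bigr (fun=> p)) => [|x ->//].
rewrite [X in _ + X](eq_bigr (fun=> q)) => [|x /negPf ->//].
rewrite !sumr_const; congr (_ + _ *+ _).
by apply: eq_card => x; rewrite !inE.
Qed.

(** Ordered pairs are counted, hence the factor 2; likewise the double sum of [adj] is twice the
    number of edges. *)
Lemma sum_cut :
  (\sum_x \sum_y ((x \in X) != (y \in X)) = 2 * (#|X| * #|~: X|))%N.
Proof.
rewrite (eq_bigr (fun x => if x \in X then #|~: X| else #|X|)) => [|x _].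
  have mulrnE (i k : nat) : i *+ k = (i * k)%N by rewrite -mulr_natr natn.
  by rewrite (sum_bipartition #|~: X| #|X|) !mulrnE mulnC mul2n -addnn.
case: (x \in X); rewrite -sum1_card [RHS]big_mkcond /=; apply: eq_bigr => y _.
  by rewrite inE; case: (y \in X).
by case: (y \in X).
Qed.

Lemma sum_adj_le : (\sum_(x : G) \sum_(y : G) adj x y <= 2 * (#|X| * #|~: X|))%N.
Proof.
rewrite -sum_cut; apply: leq_sum => x _; apply: leq_sum => y _.
by have := @adjX x y; case: adj => // ->.
Qed.

Lemma complete_of_sum_adj :
  (\sum_(x : G) \sum_(y : G) adj x y = 2 * (#|X| * #|~: X|))%N ->
  forall x y, adj x y = ((x \in X) != (y \in X)).
Proof.
rewrite -sum_cut => E x y.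
have le_row z t : (adj z t <= ((z \in X) != (t \in X)))%N.
  by have := @adjX z t; case: adj => // ->.
(* Adjacency is bounded termwise by the cut indicator, so equal totals force equal rows, and then
   equal entries. *)
have rowE : (\sum_t adj x t = \sum_t ((x \in X) != (t \in X)))%N.
  apply/eqP; move/eqP: E; apply: contraLR => ne.
  rewrite neq_ltn; apply/orP; left.
  rewrite (bigD1 x) // [ltnRHS](bigD1 x) //= -addSn leq_add //.
    by rewrite ltn_neqAle ne leq_sum.
  by apply: leq_sum => z _; apply: leq_sum.
have : nat_of_bool (adj x y) = ((x \in X) != (y \in X)).
  apply/eqP; move/eqP: rowE; apply: contraLR => ne.
  rewrite neq_ltn; apply/orP; left.
  rewrite (bigD1 y) // [ltnRHS](bigD1 y) //= -addSn leq_add //.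
    by rewrite ltn_neqAle ne le_row.
  by apply: leq_sum.
by case: adj; case: (_ != _).
Qed.

Lemma isomorphic_Kab :
  (forall x y, adj x y = ((x \in X) != (y \in X))) ->
  isomorphic G (Kab #|X| #|~: X|).
Proof.
move=> adjE; apply: isomorphic_sym.
(* The map is built out of [Kab], where [enum_val] is available on each summand; injectivity and a
   count make it bijective. *)
pose f (u : Kab #|X| #|~: X|) : G := match u with
  | inl i => enum_val (A := X) i | inr j => enum_val (A := ~: X) j end.
have fX u : (f u \in X) = if u is inl _ then true else false.
  case: u => u; first exact: enum_valP.
  by have := enum_valP u; rewrite inE => /negbTE.
exists f; last by case=> i [] j; rewrite adjE !fX.
apply: inj_card_bij; last by rewrite card_sum !card_ord cardsC.
move=> u v E; have := fX u; rewrite E fX.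
by case: u v E => i [] j //= /enum_val_inj ->.
Qed.

(** The Rayleigh bound for the vector equal to [p] on [X] and [q] off [X], doubled because each edge
    is counted in both directions. *)
Lemma lambda_bipartite_le (R : realType) (alpha p q : R) :
  lambda #|G| (A_alpha alpha G) * (#|X|%:R * p ^+ 2 + #|~: X|%:R * q ^+ 2) * 2
  <= (\sum_(x : G) \sum_(y : G) adj x y)%:R *
     (alpha * (p ^+ 2 + q ^+ 2) + 2 * (1 - alpha) * (p * q)).
Proof.
pose g (x : G) := if x \in X then p else q.
have := rayleigh (A_alpha_sym alpha G) (fun i => g (enum_val i)).
rewrite A_alpha_quad (sum_enum_val (fun x => g x ^+ 2)).
have -> : \sum_x g x ^+ 2 = #|X|%:R * p ^+ 2 + #|~: X|%:R * q ^+ 2.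
  rewrite !mulr_natl -sum_bipartition; apply: eq_bigr => x _.
  by rewrite /g; case: ifP.
set L := lambda _ _ * _; set Q := \sum_x _; set S := (_%:R * _).
(* Adding to [Q] its copy with [x] and [y] exchanged symmetrizes the summand: every adjacent pair
   carries one [p] and one [q], so contributes the same amount. *)
suff -> : S = Q + Q by rewrite mulr2n mulrDr mulr1 => LQ; rewrite lerD.
rewrite {2}/Q exchange_big -big_split /S natr_sum mulr_suml /=.
apply: eq_bigr => x _; rewrite -big_split natr_sum mulr_suml /=.
apply: eq_bigr => y _; rewrite [adj y x]adj_sym.
have := @adjX x y; case: adj; last by rewrite !mul0r addr0.
by move=> /(_ isT); rewrite /g; case: (x \in X); case: (y \in X) => // _; ring.
Qed.

End Bipartition.

(** * Comparison with the balanced complete bipartite graph *)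

Lemma isomorphic_balanced (n : nat) (G : sgraph) (X : {set G}) :
  #|G| = n -> (forall x y, adj x y = ((x \in X) != (y \in X))) ->
  (#|X| * #|~: X| = uphalf n * n./2)%N -> isomorphic G (Kab (uphalf n) n./2).
Proof.
move=> hn adjE abE; have cardX : (#|X| + #|~: X| = n)%N by rewrite cardsC.
have n_split := uphalf_half n; have n_double := odd_double_half n.
have [aE|bE] := mul_eq_halves cardX abE.
  have <- : #|~: X| = uphalf n by lia.
  (* When [X] has [n./2] elements, its complement must play the first part, so the roles are
     swapped. *)
  rewrite -aE -{2}[X]finset.setCK; apply: isomorphic_Kab => x y.
  by rewrite !inE adjE; case: (x \in X); case: (y \in X).
have <- : #|X| = uphalf n by lia.
by rewrite -bE; apply: isomorphic_Kab.
Qed.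

Lemma card_Kab (a b : nat) : #|Kab a b| = (a + b)%N.
Proof. by rewrite card_sum !card_ord. Qed.

(** This dichotomy yields both the bound and its equality case: unless [G] has all edges across a
    balanced bipartition, one inequality in the chain is strict. *)
Lemma lambda_bipartite_lt (R : realType) (n : nat) (G : sgraph) (alpha : R) :
  #|G| = n -> bipartite G -> 1 / 2 < alpha -> alpha < 1 ->
  isomorphic G (Kab (uphalf n) n./2) \/
  lambda n (A_alpha alpha G) < lambda n (A_alpha alpha (Kab (uphalf n) n./2)).
Proof.
move=> hn [X adjX] al1 al2.
set mu := lambda n (A_alpha alpha (Kab _ _)).
have cardX : (#|X| + #|~: X| = n)%N by rewrite cardsC.
have cardK : (uphalf n + n./2 = n)%N.
  by rewrite uphalf_half -addnA addnn odd_double_half.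
have abm := mul_le_halves cardX.
have Eab := sum_adj_le adjX.
set E := (\sum_(x : G) \sum_(y : G) adj x y)%N in Eab.
have [/andP[/eqP EE /eqP abE]|ne] := boolP
    ((E == 2 * (#|X| * #|~: X|)) && (#|X| * #|~: X| == uphalf n * n./2))%N.
  by left; apply: isomorphic_balanced abE => //; exact: complete_of_sum_adj.
right.
(* If this product were 0, [abm] and [Eab] would make both equalities refuted by [ne] hold; this
   disposes of [n <= 1]. *)
have m0 : (0 < uphalf n * n./2)%N by lia.
have n0 : (0 < n)%N by case: (n) m0.
have eig_mu : eigenvalue (A_alpha alpha (Kab (uphalf n) n./2)) mu.
  have K_n : #|Kab (uphalf n) n./2| = n by rewrite card_Kab.
  rewrite /mu -[X in lambda X _]K_n.
  by apply: lambda_eigenvalue; rewrite ?A_alpha_sym // K_n.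
have chi : mu ^+ 2 + (2 * alpha - 1) * (uphalf n * n./2)%:R <=
    alpha * (#|X|%:R + #|~: X|%:R) * mu.
  have := Kab_eigenvalue eig_mu.
  rewrite -natrD cardX -[X in _ * X%:R * mu]cardK natrD natrM.
  by lra.
(* By [chi], a positive multiple of [mu] is at least a positive number. *)
have mu0 : 0 < mu.
  have nR0 : 0 < #|X|%:R + #|~: X|%:R :> R by rewrite -natrD cardX ltr0n.
  have c0 : 0 < alpha * (#|X|%:R + #|~: X|%:R) by apply: mulr_gt0 => //; lra.
  rewrite -(pmulr_rgt0 _ c0); apply: lt_le_trans chi.
  apply: ltr_wpDl; first exact: sqr_ge0.
  by apply: mulr_gt0; [lra | rewrite ltr0n].
have [||p [q [N0 f0 le_mu lt_mu]]] :=
  @test_vector _ alpha mu #|X|%:R #|~: X|%:R (uphalf n * n./2)%:R al1 al2 mu0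
    (ler0n _ _) (ler0n _ _) _ _ chi.
- by rewrite -natrD cardX ltr0n.
- by rewrite -natrM ler_nat.
have := lambda_bipartite_le adjX alpha p q.
rewrite -/E -[X in _ -> lambda X _ < _]hn.
set N := (_ + _ : R) in N0 le_mu lt_mu *; set f := (_ + _ : R) in f0 le_mu lt_mu *.
move=> leE; rewrite -(ltr_pM2r N0) -(ltr_pM2r (ltr0n R 2)).
apply: le_lt_trans leE _.
have EkR : E%:R <= 2 * (#|X|%:R * #|~: X|%:R) :> R by rewrite -!natrM ler_nat.
(* A missing edge gives strictness because [f] is positive; an unbalanced bipartition gives it
   through [lt_mu]. *)
have {ne} : (E < 2 * (#|X| * #|~: X|))%N ||
    (#|X| * #|~: X| < uphalf n * n./2)%N by lia.
case/orP => [ltE|ltk].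
  have {}ltE : E%:R < 2 * (#|X|%:R * #|~: X|%:R) :> R by rewrite -!natrM ltr_nat.
  apply: lt_le_trans (_ : 2 * (#|X|%:R * #|~: X|%:R) * f <= _).
    by rewrite ltr_pM2r.
  by rewrite -mulrA [leRHS]mulrC ler_pM2l.
apply: le_lt_trans (_ : _ <= 2 * (#|X|%:R * #|~: X|%:R) * f) _.
  by rewrite ler_pM2r.
by rewrite -mulrA [ltRHS]mulrC ltr_pM2l // lt_mu // -natrM ltr_nat.
Qed.

Theorem theorem4p5 (R : realType) (n : nat) (G : sgraph) (alpha : R)
    (hn : #|G| = n) (hG : bipartite G)
    (halpha : 1 / 2 < alpha) (halpha1 : alpha < 1) :
  lambda n (A_alpha alpha G) <= lambda n (A_alpha alpha (Kab (uphalf n) n./2)) /\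
  (lambda n (A_alpha alpha G) = lambda n (A_alpha alpha (Kab (uphalf n) n./2)) <->
   isomorphic G (Kab (uphalf n) n./2)).
Proof.
have iso_eq := @lambda_isomorphic R alpha n G (Kab (uphalf n) n./2).
have [isoG|lt_lambda] := lambda_bipartite_lt hn hG halpha halpha1.
  by rewrite (iso_eq isoG).
split; first exact: ltW.
by split=> [E|/iso_eq //]; rewrite E ltxx in lt_lambda.
Qed.
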